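(* Let $(M,P,g)$ be a Riemannian almost product manifold. If $(M,P,g)$ admits an RPT-connection, then $(M,P,g)$ is a Riemannian almost product $\mathcal{W}_3$-manifold; that is, the tensor $F(x,y,z)=g((\nabla_xP)y,z)$ satisfies $$F(x,y,z)+F(y,z,x)+F(z,x,y)=0$$ for all vector fields $x,y,z$ on $M$.
   Context: A Riemannian almost product manifold $(M,P,g)$ is a differentiable manifold $M$ with a $(1,1)$-tensor field $P$ and a Riemannian metric $g$ such that $P^2x=x$, $g(Px,Py)=g(x,y)$ for all vector fields $x,y$; throughout it is assumed that $\mathrm{tr}\,P=0$ (so $\dim M$ is even). $\nabla$ is the Levi-Civita connection of $g$. A linear connection $\nabla'$ is called natural if $\nabla'P=0$ and $\nabla'g=0$. Its torsion is $T(x,y)=\nabla'_xy-\nabla'_yx-[x,y]$, and $T(x,y,z)=g(T(x,y),z)$. The torsion is totally skew-symmetric if $T(x,y,z)$ is a 3-form. An RPT-connection is a natural connection with totally skew-symmetric torsion. $(M,P,g)$ is a Riemannian almost product $\mathcal{W}_3$-manifold if the cyclic sum of $F(x,y,z)=g((\nabla_xP)y,z)$ over $x,y,z$ vanishes identically. *)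

(* Defs.v *)
From HB Require Import structures.
From mathcomp Require Import all_boot all_order all_algebra.
From mathcomp Require Import all_classical all_reals.
From mathcomp Require Import topology normedtype derive.
From mathcomp Require Import ring.

Set Implicit Arguments.
Unset Strict Implicit.
Unset Printing Implicit Defensive.
Import Order.TTheory GRing.Theory Num.Theory.
Import numFieldTopology.Exports numFieldNormedType.Exports.
Local Open Scope classical_set_scope.
Local Open Scope ring_scope.

Section Euclidean.
Context {R : realType} {n : nat}.
Implicit Types (U : set 'rV[R]_n) (f g : 'rV[R]_n -> R) (k : nat).

(* All partial derivatives of order at most k exist and are continuous at every
   point of U, which is meant to be open. *)
Fixpoint Ck k U f : Prop :=
  (forall x, U x -> {for x, continuous f}) /\
  if k is k'.+1 then
    forall i : 'I_n, (forall x, U x -> derivable f x (delta_mx 0 i)) /\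
      Ck k' U (fun x => 'D_(delta_mx 0 i) f x)
  else True.

Definition smooth_on U f : Prop := forall k, Ck k U f.

Lemma CkW k U f : Ck k.+1 U f -> Ck k U f.
Proof.
elim: k f => [|k IH] f [cf hf]; first by split.
by split=> [//|i]; have [df Df] := hf i; split=> [//|]; exact: IH.
Qed.

Let eq_continuous_on U f g : open U -> (forall x, U x -> f x = g x) ->
  (forall x, U x -> {for x, continuous f}) ->
  forall x, U x -> {for x, continuous g}.
Proof.
move=> oU fg cf x Ux.
have nfg : {near x, f =1 g}.
  by apply: filterS (open_nbhs_nbhs (conj oU Ux)) => y /fg.
have := cf x Ux; rewrite /prop_for /continuous_at (fg _ Ux) => cfx.
apply: cvg_trans cfx; exact: (@near_eq_cvg _ _ (nbhs x)  (nbhs_filter x) _ _ nfg).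
Qed.

Lemma eq_Ck k U f g : open U -> (forall x, U x -> f x = g x) ->
  Ck k U f -> Ck k U g.
Proof.
move=> oU; elim: k f g => [|k IH] f g fg [cf hf]; split=> //.
- exact: eq_continuous_on cf.
- exact: eq_continuous_on cf.
have nfg x : U x -> {near x, f =1 g}.
  by move=> Ux; apply: filterS (open_nbhs_nbhs (conj oU Ux)) => y /fg.
move=> i; have [df Df] := hf i; split=> [x Ux|].
  by apply: near_eq_derivable (nfg _ Ux) (df _ Ux).
by apply: IH Df => x Ux; exact: near_eq_derive (nfg _ Ux).
Qed.

Lemma Ck_cst k U (a : R) : Ck k U (cst a).
Proof.
elim: k a => [|k IH] a; split=> //; try by move=> x _; exact: cst_continuous.
move=> i; split=> [x _|]; first exact: derivable_cst.
rewrite (_ : (fun x => _) = cst 0) //.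
by apply/funext => x; rewrite derive_cst.
Qed.

Lemma CkD k U f g : open U -> Ck k U f -> Ck k U g -> Ck k U (f + g).
Proof.
move=> oU; elim: k f g => [|k IH] f g [cf hf] [cg hg].
  by split=> // x Ux; apply: continuousD; [exact: cf|exact: cg].
split=> [x Ux|i]; first by apply: continuousD; [exact: cf|exact: cg].
have [df Df] := hf i; have [dg Dg] := hg i; split=> [x Ux|].
  by apply: derivableD; [exact: df|exact: dg].
apply: (eq_Ck oU _ (IH _ _ Df Dg)) => x Ux.
by rewrite deriveD //; [exact: df|exact: dg].
Qed.

Lemma CkM k U f g : open U -> Ck k U f -> Ck k U g -> Ck k U (f * g).
Proof.
move=> oU; elim: k f g => [|k IH] f g.
  move=> [cf _] [cg _].
  by split=> // x Ux; apply: continuousM; [exact: cf|exact: cg].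
move=> Cf Cg; have [cf hf] := Cf; have [cg hg] := Cg.
split=> [x Ux|i]; first by apply: continuousM; [exact: cf|exact: cg].
have [df Df] := hf i; have [dg Dg] := hg i; split=> [x Ux|].
  by apply: derivableM; [exact: df|exact: dg].
apply: (eq_Ck oU _ (CkD oU (IH _ _ (CkW Cf) Dg) (IH _ _ (CkW Cg) Df))) => x Ux.
by rewrite deriveM //; [exact: df|exact: dg].
Qed.

End Euclidean.

Record chart (R : realType) (n : nat) (M : topologicalType) := Chart {
  dom : set M;
  cod : set 'rV[R]_n;
  coords : M -> 'rV[R]_n;
  param : 'rV[R]_n -> M;
  open_dom : open dom;
  open_cod : open cod;
  coords_cod : forall p, dom p -> cod (coords p);
  param_dom : forall v, cod v -> dom (param v);
  coordsK : forall p, dom p -> param (coords p) = p;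
  paramK : forall v, cod v -> coords (param v) = v;
  coords_continuous : forall p, dom p -> {for p, continuous coords};
  param_continuous : forall v, cod v -> {for v, continuous param}
}.

(* Second countability is not required: a Riemannian metric on a Hausdorff
   manifold already forces each connected component to be second countable. *)
Record manifold (R : realType) (n : nat) := Manifold {
  point_of :> topologicalType;
  atlas : set (chart R n point_of);
  manifold_hausdorff : hausdorff_space point_of;
  atlas_cover : forall p, exists2 c, atlas c & dom c p;
  atlas_compat : forall c d, atlas c -> atlas d -> forall i,
    smooth_on (cod c `&` param c @^-1` dom d)
              (fun v => coords d (param c v) 0 i)
}.

Section SmoothFunctions.
Context {R : realType} {n : nat} (M : manifold R n).
Implicit Types f g : M -> R.

Definition smooth_fun : {pred (M -> R)} := fun f =>
  `[< forall c, atlas c -> smooth_on (cod c) (f \o param c) >].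

Lemma smooth_fun_cst (a : R) : (cst a : M -> R) \in smooth_fun.
Proof. by apply/asboolP => c _ k; exact: Ck_cst. Qed.

Lemma smooth_funD f g :
  f \in smooth_fun -> g \in smooth_fun -> f + g \in smooth_fun.
Proof.
move=> /asboolP hf /asboolP hg; apply/asboolP => c ac k.
rewrite (_ : (f + g) \o _ = (f \o param c) + (g \o param c)) //.
exact: (CkD (@open_cod _ _ _ c) (hf c ac k) (hg c ac k)).
Qed.

Lemma smooth_funM f g :
  f \in smooth_fun -> g \in smooth_fun -> f * g \in smooth_fun.
Proof.
move=> /asboolP hf /asboolP hg; apply/asboolP => c ac k.
rewrite (_ : (f * g) \o _ = (f \o param c) * (g \o param c)) //.
exact: (CkM (@open_cod _ _ _ c) (hf c ac k) (hg c ac k)).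
Qed.

Lemma smooth_funZ (a : R) f : f \in smooth_fun -> a *: f \in smooth_fun.
Proof. exact: (smooth_funM (smooth_fun_cst a)). Qed.

Lemma smooth_funB f g :
  f \in smooth_fun -> g \in smooth_fun -> f - g \in smooth_fun.
Proof.
by move=> hf hg; rewrite -scaleN1r; apply: smooth_funD => //; exact: smooth_funZ.
Qed.

Lemma smooth_fun_subring : subring_closed smooth_fun.
Proof.
split; [exact: (smooth_fun_cst 1)|exact: smooth_funB|exact: smooth_funM].
Qed.

HB.instance Definition _ :=
  GRing.isSubringClosed.Build _ smooth_fun smooth_fun_subring.
HB.instance Definition _ :=
  GRing.isScaleClosed.Build R _ smooth_fun smooth_funZ.

Record Cinf := MkCinf { Cinf_fun :> M -> R; _ : Cinf_fun \in smooth_fun }.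

HB.instance Definition _ := [isSub for Cinf_fun].
HB.instance Definition _ := [Choice of Cinf by <:].
HB.instance Definition _ :=
  GRing.SubChoice_isSubComPzRing.Build _ _ Cinf (subringClosedP smooth_fun).
HB.instance Definition _ := [SubZmodule_isSubLmodule of Cinf by <:].

Lemma CinfP (f : Cinf) : (f : M -> R) \in smooth_fun.
Proof. exact: valP. Qed.

Lemma eq_Cinf (f g : Cinf) : (forall p, f p = g p) -> f = g.
Proof. by move=> fg; apply/val_inj/funext. Qed.

End SmoothFunctions.

Section TangentSpace.
Context {R : realType} {n : nat} {M : manifold R n} (p : M).

Definition derivation : {pred (Cinf M -> R)} := fun v =>
  `[< (forall (a : R) f g, v (a *: f + g) = a * v f + v g) /\
      (forall f g, v (f * g) = f p * v g + v f * g p) >].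

Lemma derivation_submod : submod_closed derivation.
Proof.
split=> [|a v w /asboolP[vL vM] /asboolP[wL wM]].
  apply/asboolP; split=> [b f g|f g]; rewrite /GRing.zero /=.
    by rewrite mulr0 addr0.
  by rewrite mulr0 mul0r addr0.
have E f : (a *: v + w) f = a * v f + w f by [].
apply/asboolP; split=> [b f g|f g]; rewrite !E.
  by rewrite vL wL; ring.
by rewrite vM wM; ring.
Qed.

HB.instance Definition _ :=
  GRing.isSubmodClosed.Build _ _ derivation derivation_submod.

Record tangent :=
  MkTangent { tangent_fun :> Cinf M -> R; _ : tangent_fun \in derivation }.

HB.instance Definition _ := [isSub for tangent_fun].
HB.instance Definition _ := [Choice of tangent by <:].
HB.instance Definition _ := [SubChoice_isSubLmodule of tangent by <:].

Lemma tangentP (v : tangent) : (v : Cinf M -> R) \in derivation.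
Proof. exact: valP. Qed.

Lemma eq_tangent (v w : tangent) : (forall f, v f = w f) -> v = w.
Proof. by move=> vw; apply/val_inj/funext. Qed.

Lemma tangentL (v : tangent) (a : R) f g : v (a *: f + g) = a * v f + v g.
Proof. by have /asboolP[vL _] := tangentP v; rewrite vL. Qed.

Lemma tangentM (v : tangent) f g : v (f * g) = f p * v g + v f * g p.
Proof. by have /asboolP[_ vM] := tangentP v; rewrite vM. Qed.

Lemma tangentD (v : tangent) f g : v (f + g) = v f + v g.
Proof. by rewrite -[f in LHS]scale1r tangentL mul1r. Qed.

Lemma tangentN (v : tangent) f : v (- f) = - v f.
Proof.
apply/eqP; rewrite -addr_eq0 -tangentD addNr; apply/eqP.
have := tangentD v 0 0; rewrite addr0 => /eqP.
by rewrite -subr_eq subrr eq_sym => /eqP.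
Qed.

End TangentSpace.

Section VectorFields.
Context {R : realType} {n : nat} {M : manifold R n}.

Record vfield := MkVfield {
  vfield_at :> forall p : M, tangent p;
  vfield_smooth : forall f, (fun p => vfield_at p f) \in @smooth_fun R n M
}.

Lemma eq_vfield (X Y : vfield) : (forall p f, X p f = Y p f) -> X = Y.
Proof.
case: X Y => [X sX] [Y sY] /= XY.
have E : X = Y by apply: functional_extensionality_dep => p; exact: eq_tangent.
by case: _ / E in sY *; congr MkVfield; exact: Prop_irrelevance.
Qed.

HB.instance Definition _ := gen_eqMixin vfield.
HB.instance Definition _ := gen_choiceMixin vfield.

Definition vfield_app (X : vfield) (f : Cinf M) : Cinf M :=
  MkCinf (vfield_smooth X f).

Definition vfield0 : vfield :=
  @MkVfield (fun p => 0) (fun f => smooth_fun_cst M 0).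

Definition vfieldD (X Y : vfield) : vfield :=
  @MkVfield (fun p => X p + Y p)
    (fun f => smooth_funD (vfield_smooth X f) (vfield_smooth Y f)).

Definition vfieldN (X : vfield) : vfield :=
  @MkVfield (fun p => - X p) (fun f => CinfP (- vfield_app X f)).

Definition vfieldZ (h : Cinf M) (X : vfield) : vfield :=
  @MkVfield (fun p => h p *: X p) (fun f => CinfP (h * vfield_app X f)).

Fact vfieldDA : associative vfieldD.
Proof. by move=> X Y Z; apply: eq_vfield => p f /=; rewrite addrA. Qed.
Fact vfieldDC : commutative vfieldD.
Proof. by move=> X Y; apply: eq_vfield => p f /=; rewrite addrC. Qed.
Fact vfield0D : left_id vfield0 vfieldD.
Proof. by move=> X; apply: eq_vfield => p f /=; rewrite add0r. Qed.
Fact vfieldND : left_inverse vfield0 vfieldN vfieldD.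
Proof. by move=> X; apply: eq_vfield => p f /=; rewrite addNr. Qed.
HB.instance Definition _ :=
  GRing.isZmodule.Build vfield vfieldDA vfieldDC vfield0D vfieldND.

Fact vfieldZA (a b : Cinf M) X : vfieldZ a (vfieldZ b X) = vfieldZ (a * b) X.
Proof. by apply: eq_vfield => p f /=; rewrite scalerA. Qed.
Fact vfield1Z : left_id 1 vfieldZ.
Proof. by move=> X; apply: eq_vfield => p f /=; rewrite scale1r. Qed.
Fact vfieldZDr : right_distributive vfieldZ +%R.
Proof. by move=> a X Y; apply: eq_vfield => p f /=; rewrite scalerDr. Qed.
Fact vfieldZDl X : {morph vfieldZ^~ X : a b / a + b}.
Proof. by move=> a b; apply: eq_vfield => p f /=; rewrite -scalerDl. Qed.
HB.instance Definition _ := GRing.Zmodule_isLmodule.Build (Cinf M) vfield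
  vfieldZA vfield1Z vfieldZDr vfieldZDl.

Lemma vfield_appL (X : vfield) (a : R) f g :
  vfield_app X (a *: f + g) = a *: vfield_app X f + vfield_app X g.
Proof. by apply: eq_Cinf => p; exact: tangentL. Qed.

Lemma vfield_appM (X : vfield) f g :
  vfield_app X (f * g) = f * vfield_app X g + vfield_app X f * g.
Proof. by apply: eq_Cinf => p; exact: tangentM. Qed.

Lemma bracket_derivation (X Y : vfield) (p : M) :
  (fun f => X p (vfield_app Y f) - Y p (vfield_app X f)) \in derivation p.
Proof.
apply/asboolP; split=> [a f g|f g].
  by rewrite !vfield_appL !tangentL mulrBr opprD addrACA.
rewrite !vfield_appM !tangentD !tangentM /=.
ring.
Qed.

Definition bracket (X Y : vfield) : vfield :=
  @MkVfield (fun p => MkTangent (bracket_derivation X Y p))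
    (fun f => CinfP (vfield_app X (vfield_app Y f) -
                     vfield_app Y (vfield_app X f))).

End VectorFields.
Arguments vfield {R n} M.

Section Tensors.
Context {R : realType} {n : nat} {M : manifold R n}.

Record tensor11 := MkTensor11 {
  tensor11_at : forall p : M, {linear tangent p -> tangent p};
  tensor11_smooth : forall (X : vfield M) f,
    (fun p => tensor11_at p (X p) f) \in @smooth_fun R n M
}.

Definition tensor11_app (P : tensor11) (X : vfield M) : vfield M :=
  @MkVfield R n M (fun p => tensor11_at P p (X p)) (tensor11_smooth P X).

Definition is_basis (p : M) (k : nat) (e : 'I_k -> tangent p) : Prop :=
  forall v, exists! a : 'rV[R]_k, v = \sum_i a 0 i *: e i.

Definition is_trace_at (P : tensor11) (p : M) (t : R) : Prop :=
  exists (e : 'I_n -> tangent p) (A : 'M[R]_n),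
    [/\ is_basis e,
        forall j, tensor11_at P p (e j) = \sum_i A i j *: e i
      & t = \tr A].

Record riemannian_metric := MkMetric {
  metric_at : forall p : M, tangent p -> tangent p -> R;
  metric_linear : forall p (a : R) (u v w : tangent p),
    metric_at (a *: u + v) w = a * metric_at u w + metric_at v w;
  metric_sym : forall p (u v : tangent p), metric_at u v = metric_at v u;
  metric_pos : forall p (u : tangent p), u != 0 -> 0 < metric_at u u;
  metric_smooth : forall X Y : vfield M,
    (fun p => metric_at (X p) (Y p)) \in @smooth_fun R n M
}.

Definition metric_app (g : riemannian_metric) (X Y : vfield M) : Cinf M :=
  MkCinf (metric_smooth g X Y).

Record connection := MkConnection {
  cov : vfield M -> vfield M -> vfield M;
  cov_addl : forall X Y Z, cov (X + Y) Z = cov X Z + cov Y Z;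
  cov_scalel : forall (f : Cinf M) X Y, cov (f *: X) Y = f *: cov X Y;
  cov_addr : forall X Y Z, cov X (Y + Z) = cov X Y + cov X Z;
  cov_leibniz : forall (f : Cinf M) X Y,
    cov X (f *: Y) = vfield_app X f *: Y + f *: cov X Y
}.

End Tensors.
Arguments tensor11 {R n} M.
Arguments riemannian_metric {R n} M.
Arguments connection {R n} M.
Coercion tensor11_app : tensor11 >-> Funclass.
Coercion metric_app : riemannian_metric >-> Funclass.
Coercion cov : connection >-> Funclass.

Section AlmostProduct.
Context {R : realType} {n : nat} {M : manifold R n}.
Implicit Types (P : tensor11 M) (g : riemannian_metric M) (D : connection M).

Definition riemannian_almost_product P g : Prop :=
  [/\ forall x, P (P x) = x,
      forall x y, g (P x) (P y) = g x y
    & forall p, is_trace_at P p 0].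

Definition cov_tensor11 D P (x y : vfield M) : vfield M := D x (P y) - P (D x y).

Definition cov_metric D g (x y z : vfield M) : Cinf M :=
  vfield_app x (g y z) - g (D x y) z - g y (D x z).

Definition torsion D (x y : vfield M) : vfield M := D x y - D y x - bracket x y.

Definition levi_civita g D : Prop :=
  (forall x y, torsion D x y = 0) /\ (forall x y z, cov_metric D g x y z = 0).

Definition natural_connection P g D : Prop :=
  (forall x y, cov_tensor11 D P x y = 0) /\
  (forall x y z, cov_metric D g x y z = 0).

Definition torsion3 D g (x y z : vfield M) : Cinf M := g (torsion D x y) z.

(* C^infty(M)-trilinearity of T(x,y,z) holds for every connection, so being a
   3-form amounts to changing sign under the transpositions of arguments. *)
Definition skew_torsion D g : Prop :=
  (forall x y z, torsion3 D g y x z = - torsion3 D g x y z) /\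
  (forall x y z, torsion3 D g x z y = - torsion3 D g x y z).

Definition RPT_connection P g D : Prop :=
  natural_connection P g D /\ skew_torsion D g.

Definition tensorF P g D (x y z : vfield M) : Cinf M :=
  g (cov_tensor11 D P x y) z.

Definition W3_manifold P g D : Prop := forall x y z : vfield M,
  tensorF P g D x y z + tensorF P g D y z x + tensorF P g D z x y = 0.

End AlmostProduct.

(* Main.v *)
(** Let [A x y = nabla' x y - nabla x y].  Both connections are metric, so
    [B(x,y,z) = g (A x y) z] is skew in [y, z]; as [nabla] is torsion-free,
    [T(x,y,z) = B(x,y,z) - B(y,x,z)], and the skewness of [T] in [y, z] then
    makes [B] skew in [x, z] as well.  Since [nabla' P = 0] and [P] is
    self-adjoint, [F(x,y,z) = B(x,y,P z) - B(x,P y,z)], and the cyclic sum of the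
    right-hand side vanishes by cyclic invariance of [B]. *)
Require Import Defs.
From mathcomp Require Import all_boot all_order all_algebra all_classical all_reals.
From mathcomp Require Import ring.

Set Implicit Arguments.
Unset Strict Implicit.
Unset Printing Implicit Defensive.
Import GRing.Theory.
Local Open Scope ring_scope.

Section MetricAndTensor.
Context {R : realType} {n : nat} {M : manifold R n}.
Implicit Types (P : tensor11 M) (g : riemannian_metric M) (D : connection M).

Lemma metric_appC g (x y : vfield M) : g x y = g y x.
Proof. by apply: eq_Cinf => p; exact: metric_sym. Qed.

Lemma metric_appBl g (x y z : vfield M) : g (x - y) z = g x z - g y z.
Proof.
apply: eq_Cinf => p /=.
by rewrite addrC -scaleN1r metric_linear mulN1r addrC.
Qed.

Lemma metric_appBr g (x y z : vfield M) : g x (y - z) = g x y - g x z.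
Proof. by rewrite metric_appC metric_appBl ![g _ x]metric_appC. Qed.

Lemma tensor11_appB P (x y : vfield M) : P (x - y) = P x - P y.
Proof. by apply: eq_vfield => p f /=; rewrite raddfB. Qed.

(** Apply the isometry [P] to both arguments and use that it is an involution. *)
Lemma almost_product_self_adjoint P g (x y : vfield M) :
  riemannian_almost_product P g -> g (P x) y = g x (P y).
Proof. by case=> PP gP _; rewrite -[LHS]gP PP. Qed.

Definition diff_tensor D D' (x y : vfield M) : vfield M := D' x y - D x y.

(** The term [vfield_app x (g y z)] is common to both metricity conditions and cancels in their
    difference. *)
Lemma diff_tensor_skew g D D' (x y z : vfield M) :
  (forall x y z, cov_metric D g x y z = 0) ->
  (forall x y z, cov_metric D' g x y z = 0) ->
  g (diff_tensor D D' x z) y = - g (diff_tensor D D' x y) z.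
Proof.
move=> Dg D'g; apply/eqP; rewrite -addr_eq0; apply/eqP.
rewrite !metric_appBl [g (D' x z) y]metric_appC [g (D x z) y]metric_appC.
transitivity (cov_metric D g x y z - cov_metric D' g x y z).
  by rewrite /cov_metric; ring.
by rewrite Dg D'g subrr.
Qed.

(** Zero torsion of [D] turns [bracket x y] into [D x y - D y x]. *)
Lemma torsion_diff_tensor D D' (x y : vfield M) :
  torsion D x y = 0 ->
  torsion D' x y = diff_tensor D D' x y - diff_tensor D D' y x.
Proof.
move=> /subr0_eq E.
by rewrite /torsion -E /diff_tensor opprD addrACA -opprD.
Qed.

Lemma diff_tensor_skew13 g D D' (x y z : vfield M) :
  levi_civita g D -> (forall x y z, cov_metric D' g x y z = 0) ->
  skew_torsion D' g ->
  g (diff_tensor D D' z y) x = - g (diff_tensor D D' x y) z.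
Proof.
move=> [D0 Dg] D'g [_ T23].
(* In T(y,z,x) = -T(y,x,z), the terms B(y,z,x) and -B(y,x,z) agree by metricity; cancelling them
   leaves -B(z,y,x) = B(x,y,z). *)
have := T23 y x z.
rewrite /torsion3 !(torsion_diff_tensor _ (D0 _ _)).
rewrite (metric_appBl g (diff_tensor D D' y z)) (metric_appBl g (diff_tensor D D' y x)).
rewrite (diff_tensor_skew y x z Dg D'g).
by rewrite opprB [RHS]addrC => /addrI <-; rewrite opprK.
Qed.

(** A 3-cycle is a product of two transpositions, so the two signs cancel. *)
Lemma diff_tensor_cycle g D D' (x y z : vfield M) :
  levi_civita g D -> (forall x y z, cov_metric D' g x y z = 0) ->
  skew_torsion D' g ->
  g (diff_tensor D D' y z) x = g (diff_tensor D D' x y) z.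
Proof.
move=> LC D'g T; rewrite (diff_tensor_skew13 x z y LC D'g T).
by rewrite (diff_tensor_skew x z y (proj2 LC) D'g).
Qed.

Lemma tensorF_diff_tensor P g D D' (x y z : vfield M) :
  riemannian_almost_product P g -> (forall x y, cov_tensor11 D' P x y = 0) ->
  tensorF P g D x y z =
    g (diff_tensor D D' x y) (P z) - g (diff_tensor D D' x (P y)) z.
Proof.
move=> gP D'P; rewrite -(almost_product_self_adjoint _ _ gP) -metric_appBl.
congr (metric_app g _ z); rewrite tensor11_appB.
have /eqP := D'P x y; rewrite subr_eq0 => /eqP E.
by rewrite /diff_tensor E opprB [RHS]addrC addrA subrK.
Qed.

End MetricAndTensor.

Theorem theorem2p2 (R : realType) (n : nat) (M : manifold R n)
    (P : tensor11 M) (g : riemannian_metric M) (nabla : connection M) :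
  riemannian_almost_product P g ->
  levi_civita g nabla ->
  (exists nabla' : connection M, RPT_connection P g nabla') ->
  W3_manifold P g nabla.
Proof.
move=> gP LC [nabla' [[D'P D'g] T]] x y z.
rewrite !(tensorF_diff_tensor _ _ _ _ gP D'P).
have cyc a b c := diff_tensor_cycle a b c LC D'g T.
(* Each negative term is a cyclic shift of the positive term in which [P] acts on the same field. *)
rewrite (cyc x y (P z)) (cyc y z (P x)).
rewrite -(cyc z x (P y)).
ring.
Qed.
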